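(* (Equivalence between $\mathrm{SLT}_{\omega}$ and $\mathrm{LT}_{\omega}$.) For every formula $\alpha$, the sequent $\Rightarrow \alpha$ (empty antecedent) is derivable in $\mathrm{SLT}_{\omega}$ if and only if the sequent $\Rightarrow\alpha$ is derivable in $\mathrm{LT}_{\omega}$.
   Context: Formulas are built from countably many propositional variables $p,q,\dots$ using binary $\to,\wedge,\vee$ and unary $\neg,\mathrm{G},\mathrm{F},\mathrm{X}$. $\mathrm{X}^0\alpha := \alpha$, $\mathrm{X}^{n+1}\alpha := \mathrm{X}^n\mathrm{X}\alpha$. $\Gamma,\Delta,\Sigma,\Pi$ denote finite (possibly empty) sets of formulas; commas denote union. Derivations are well-founded, possibly infinitely branching trees. In all rules $i,k$ are arbitrary natural numbers and $p$ a propositional variable. $\mathrm{LT}_{\omega}$: sequents $\Gamma\Rightarrow\Delta$. Initial sequents $\mathrm{X}^ip\Rightarrow\mathrm{X}^ip$. Rules: (cut) from $\Gamma\Rightarrow\Delta,\alpha$ and $\alpha,\Sigma\Rightarrow\Pi$ infer $\Gamma,\Sigma\Rightarrow\Delta,\Pi$; (we-left) from $\Gamma\Rightarrow\Delta$ infer $\alpha,\Gamma\Rightarrow\Delta$; (we-right) from $\Gamma\Rightarrow\Delta$ infer $\Gamma\Rightarrow\Delta,\alpha$; ($\to$left) from $\Gamma\Rightarrow\Delta,\mathrm{X}^i\alpha$ and $\mathrm{X}^i\beta,\Gamma\Rightarrow\Delta$ infer $\mathrm{X}^i(\alpha\to\beta),\Gamma\Rightarrow\Delta$; ($\to$right) from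 $\mathrm{X}^i\alpha,\Gamma\Rightarrow\Delta,\mathrm{X}^i\beta$ infer $\Gamma\Rightarrow\Delta,\mathrm{X}^i(\alpha\to\beta)$; ($\neg$left) from $\Gamma\Rightarrow\Delta,\mathrm{X}^i\alpha$ infer $\mathrm{X}^i\neg\alpha,\Gamma\Rightarrow\Delta$; ($\neg$right) from $\mathrm{X}^i\alpha,\Gamma\Rightarrow\Delta$ infer $\Gamma\Rightarrow\Delta,\mathrm{X}^i\neg\alpha$; ($\wedge$left) from $\mathrm{X}^i\alpha,\mathrm{X}^i\beta,\Gamma\Rightarrow\Delta$ infer $\mathrm{X}^i(\alpha\wedge\beta),\Gamma\Rightarrow\Delta$; ($\wedge$right) from $\Gamma\Rightarrow\Delta,\mathrm{X}^i\alpha$ and $\Gamma\Rightarrow\Delta,\mathrm{X}^i\beta$ infer $\Gamma\Rightarrow\Delta,\mathrm{X}^i(\alpha\wedge\beta)$; ($\vee$left) from $\mathrm{X}^i\alpha,\Gamma\Rightarrow\Delta$ and $\mathrm{X}^i\beta,\Gamma\Rightarrow\Delta$ infer $\mathrm{X}^i(\alpha\vee\beta),\Gamma\Rightarrow\Delta$; ($\vee$right) from $\Gamma\Rightarrow\Delta,\mathrm{X}^i\alpha,\mathrm{X}^i\beta$ infer $\Gamma\Rightarrow\Delta,\mathrm{X}^i(\alpha\vee\beta)$; (Gleft) from $\mathrm{X}^{i+k}\alpha,\Gamma\Rightarrow\Delta$ infer $\mathrm{X}^i\mathrm{G}\alpha,\Gamma\Rightarrow\Delta$; (Gright) from all $\Gamma\Rightarrow\Delta,\mathrm{X}^{i+j}\alpha$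 ($j\in\omega$) infer $\Gamma\Rightarrow\Delta,\mathrm{X}^i\mathrm{G}\alpha$; (Fleft) from all $\mathrm{X}^{i+j}\alpha,\Gamma\Rightarrow\Delta$ ($j\in\omega$) infer $\mathrm{X}^i\mathrm{F}\alpha,\Gamma\Rightarrow\Delta$; (Fright) from $\Gamma\Rightarrow\Delta,\mathrm{X}^{i+k}\alpha$ infer $\Gamma\Rightarrow\Delta,\mathrm{X}^i\mathrm{F}\alpha$. $\mathrm{SLT}_{\omega}$: sequents $\Gamma\Rightarrow\gamma$ with $\gamma$ a single formula or empty. Initial sequents $\mathrm{X}^ip,\Gamma\Rightarrow\mathrm{X}^ip$. Rules ($\gamma$ a formula or empty): (cut) from $\Gamma\Rightarrow\alpha$ and $\alpha,\Sigma\Rightarrow\gamma$ infer $\Gamma,\Sigma\Rightarrow\gamma$; (we-right) from $\Gamma\Rightarrow$ infer $\Gamma\Rightarrow\alpha$; ($\to$left) from $\Gamma\Rightarrow\mathrm{X}^i\alpha$ and $\mathrm{X}^i\beta,\Gamma\Rightarrow\gamma$ infer $\mathrm{X}^i(\alpha\to\beta),\Gamma\Rightarrow\gamma$; ($\to$right) from $\mathrm{X}^i\alpha,\Gamma\Rightarrow\mathrm{X}^i\beta$ infer $\Gamma\Rightarrow\mathrm{X}^i(\alpha\to\beta)$; ($\neg$left) from $\Gamma\Rightarrow\mathrm{X}^i\alpha$ infer $\mathrm{X}^i\neg\alpha,\Gamma\Rightarrow$; ($\neg$right) from $\mathrm{X}^i\alpha,\Gamma\Rightarrow$ infer $\Gamma\Rightarrow\mathrm{X}^i\neg\alpha$;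 (ex-middle) from $\mathrm{X}^i\neg\alpha,\Gamma\Rightarrow\gamma$ and $\mathrm{X}^i\alpha,\Gamma\Rightarrow\gamma$ infer $\Gamma\Rightarrow\gamma$; ($\wedge$left) from $\mathrm{X}^i\alpha,\mathrm{X}^i\beta,\Gamma\Rightarrow\gamma$ infer $\mathrm{X}^i(\alpha\wedge\beta),\Gamma\Rightarrow\gamma$; ($\wedge$right) from $\Gamma\Rightarrow\mathrm{X}^i\alpha$ and $\Gamma\Rightarrow\mathrm{X}^i\beta$ infer $\Gamma\Rightarrow\mathrm{X}^i(\alpha\wedge\beta)$; ($\vee$left) from $\mathrm{X}^i\alpha,\Gamma\Rightarrow\gamma$ and $\mathrm{X}^i\beta,\Gamma\Rightarrow\gamma$ infer $\mathrm{X}^i(\alpha\vee\beta),\Gamma\Rightarrow\gamma$; ($\vee$right1/2) from $\Gamma\Rightarrow\mathrm{X}^i\alpha$ (resp. $\Gamma\Rightarrow\mathrm{X}^i\beta$) infer $\Gamma\Rightarrow\mathrm{X}^i(\alpha\vee\beta)$; (Gleft) from $\mathrm{X}^{i+k}\alpha,\Gamma\Rightarrow\gamma$ infer $\mathrm{X}^i\mathrm{G}\alpha,\Gamma\Rightarrow\gamma$; (Gright) from all $\Gamma\Rightarrow\mathrm{X}^{i+j}\alpha$ ($j\in\omega$) infer $\Gamma\Rightarrow\mathrm{X}^i\mathrm{G}\alpha$; (Fleft) from all $\mathrm{X}^{i+j}\alpha,\Gamma\Rightarrow\gamma$ ($j\in\omega$) infer $\mathrm{X}^i\mathrm{F}\alpha,\Gamma\Rightarrow\gamma$;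 (Fright) from $\Gamma\Rightarrow\mathrm{X}^{i+k}\alpha$ infer $\Gamma\Rightarrow\mathrm{X}^i\mathrm{F}\alpha$. *)

(* Defs.v *)
From HB Require Import structures.
From mathcomp Require Import all_boot finmap.

Set Implicit Arguments.
Unset Strict Implicit.
Unset Printing Implicit Defensive.

Local Open Scope fset_scope.

Inductive form : Type :=
| Var of nat
| Imp of form & form
| And of form & form
| Or of form & form
| Neg of form
| Glob of form
| Fut of form
| Next of form.

(* Encoding into generic trees, used only to equip [form] with the choice
   structure required by finite sets. *)
Fixpoint form_encode (a : form) : GenTree.tree nat :=
  match a with
  | Var n => GenTree.Leaf n
  | Imp a b => GenTree.Node 0 [:: form_encode a; form_encode b]
  | And a b => GenTree.Node 1 [:: form_encode a; form_encode b]
  | Or a b => GenTree.Node 2 [:: form_encode a; form_encode b]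
  | Neg a => GenTree.Node 3 [:: form_encode a]
  | Glob a => GenTree.Node 4 [:: form_encode a]
  | Fut a => GenTree.Node 5 [:: form_encode a]
  | Next a => GenTree.Node 6 [:: form_encode a]
  end.

Fixpoint form_decode (t : GenTree.tree nat) : form :=
  match t with
  | GenTree.Leaf n => Var n
  | GenTree.Node 0 [:: a; b] => Imp (form_decode a) (form_decode b)
  | GenTree.Node 1 [:: a; b] => And (form_decode a) (form_decode b)
  | GenTree.Node 2 [:: a; b] => Or (form_decode a) (form_decode b)
  | GenTree.Node 3 [:: a] => Neg (form_decode a)
  | GenTree.Node 4 [:: a] => Glob (form_decode a)
  | GenTree.Node 5 [:: a] => Fut (form_decode a)
  | GenTree.Node 6 [:: a] => Next (form_decode a)
  | _ => Var 0
  end.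

Lemma form_encodeK : cancel form_encode form_decode.
Proof. by elim=> //= [a -> b ->|a -> b ->|a -> b ->|a ->|a ->|a ->|a ->]. Qed.

HB.instance Definition _ := Countable.copy form (can_type form_encodeK).

Fixpoint Xn (n : nat) (a : form) : form :=
  match n with
  | 0 => a
  | n'.+1 => Xn n' (Next a)
  end.

(* [LT G D]: the sequent G => D is derivable in LT_omega.  The premises of
   [LT_Gr] and [LT_Fl] range over all of nat, so the derivations are
   well-founded, infinitely branching trees. *)
Inductive LT : {fset form} -> {fset form} -> Prop :=
| LT_init i p : LT [fset Xn i (Var p)] [fset Xn i (Var p)]
| LT_cut G D S P a :
    LT G (a |` D) -> LT (a |` S) P -> LT (G `|` S) (D `|` P)
| LT_wl a G D : LT G D -> LT (a |` G) D
| LT_wr a G D : LT G D -> LT G (a |` D)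
| LT_impl i a b G D :
    LT G (Xn i a |` D) -> LT (Xn i b |` G) D -> LT (Xn i (Imp a b) |` G) D
| LT_impr i a b G D :
    LT (Xn i a |` G) (Xn i b |` D) -> LT G (Xn i (Imp a b) |` D)
| LT_negl i a G D : LT G (Xn i a |` D) -> LT (Xn i (Neg a) |` G) D
| LT_negr i a G D : LT (Xn i a |` G) D -> LT G (Xn i (Neg a) |` D)
| LT_andl i a b G D :
    LT (Xn i a |` (Xn i b |` G)) D -> LT (Xn i (And a b) |` G) D
| LT_andr i a b G D :
    LT G (Xn i a |` D) -> LT G (Xn i b |` D) -> LT G (Xn i (And a b) |` D)
| LT_orl i a b G D :
    LT (Xn i a |` G) D -> LT (Xn i b |` G) D -> LT (Xn i (Or a b) |` G) D
| LT_orr i a b G D :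
    LT G (Xn i a |` (Xn i b |` D)) -> LT G (Xn i (Or a b) |` D)
| LT_Gl i k a G D : LT (Xn (i + k) a |` G) D -> LT (Xn i (Glob a) |` G) D
| LT_Gr i a G D :
    (forall j, LT G (Xn (i + j) a |` D)) -> LT G (Xn i (Glob a) |` D)
| LT_Fl i a G D :
    (forall j, LT (Xn (i + j) a |` G) D) -> LT (Xn i (Fut a) |` G) D
| LT_Fr i k a G D : LT G (Xn (i + k) a |` D) -> LT G (Xn i (Fut a) |` D).

(* [SLT G c]: the sequent G => c is derivable in SLT_omega; the succedent is
   [None] when empty. *)
Inductive SLT : {fset form} -> option form -> Prop :=
| SLT_init i p G : SLT (Xn i (Var p) |` G) (Some (Xn i (Var p)))
| SLT_cut G S a c : SLT G (Some a) -> SLT (a |` S) c -> SLT (G `|` S) c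
| SLT_wr a G : SLT G None -> SLT G (Some a)
| SLT_impl i a b G c :
    SLT G (Some (Xn i a)) -> SLT (Xn i b |` G) c ->
    SLT (Xn i (Imp a b) |` G) c
| SLT_impr i a b G :
    SLT (Xn i a |` G) (Some (Xn i b)) -> SLT G (Some (Xn i (Imp a b)))
| SLT_negl i a G : SLT G (Some (Xn i a)) -> SLT (Xn i (Neg a) |` G) None
| SLT_negr i a G : SLT (Xn i a |` G) None -> SLT G (Some (Xn i (Neg a)))
| SLT_em i a G c :
    SLT (Xn i (Neg a) |` G) c -> SLT (Xn i a |` G) c -> SLT G c
| SLT_andl i a b G c :
    SLT (Xn i a |` (Xn i b |` G)) c -> SLT (Xn i (And a b) |` G) c
| SLT_andr i a b G :
    SLT G (Some (Xn i a)) -> SLT G (Some (Xn i b)) ->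
    SLT G (Some (Xn i (And a b)))
| SLT_orl i a b G c :
    SLT (Xn i a |` G) c -> SLT (Xn i b |` G) c -> SLT (Xn i (Or a b) |` G) c
| SLT_orr1 i a b G : SLT G (Some (Xn i a)) -> SLT G (Some (Xn i (Or a b)))
| SLT_orr2 i a b G : SLT G (Some (Xn i b)) -> SLT G (Some (Xn i (Or a b)))
| SLT_Gl i k a G c : SLT (Xn (i + k) a |` G) c -> SLT (Xn i (Glob a) |` G) c
| SLT_Gr i a G :
    (forall j, SLT G (Some (Xn (i + j) a))) -> SLT G (Some (Xn i (Glob a)))
| SLT_Fl i a G c :
    (forall j, SLT (Xn (i + j) a |` G) c) -> SLT (Xn i (Fut a) |` G) c
| SLT_Fr i k a G :
    SLT G (Some (Xn (i + k) a)) -> SLT G (Some (Xn i (Fut a))).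

(* Main.v *)
Require Import Defs.
From mathcomp Require Import all_boot finmap.

Local Open Scope fset_scope.

(** A sequent [G => D] of LT_omega is read in SLT_omega as [G, ~D =>].  Excluded
    middle, together with the identity sequents, lets any single formula of [D]
    be moved back to the succedent, where the rule of SLT_omega applies; the
    result is then negated back into the antecedent.  Conversely, SLT_omega is a
    restriction of LT_omega in which excluded middle is a cut on a negation. *)

(** Left weakening is admissible because initial sequents carry an arbitrary context; at a cut only
    the second premise absorbs [H]. With [H] on the right, reassociation keeps the principal formula
    at the head. *)
Lemma SLT_weakenU {G c} (H : {fset form}) : SLT G c -> SLT (G `|` H) c.
Proof.
move=> d; elim: d H => {G c}
  [i p G|G S a c dG _ _ IHS|a G _ IH|i a b G c _ IHa _ IHb|i a b G _ IH
  |i a G _ IH|i a G _ IH|i a G c _ IHn _ IHa|i a b G c _ IH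
  |i a b G _ IHa _ IHb|i a b G c _ IHa _ IHb|i a b G _ IH|i a b G _ IH
  |i k a G c _ IH|i a G _ IH|i a G c _ IH|i k a G _ IH] H; rewrite -?fsetUA.
- exact: SLT_init.
- by apply: (SLT_cut dG); rewrite fsetUA.
- exact: SLT_wr.
- by apply: SLT_impl; rewrite ?fsetUA.
- by apply: SLT_impr; rewrite fsetUA.
- exact: SLT_negl.
- by apply: SLT_negr; rewrite fsetUA.
- by apply: (@SLT_em i a); rewrite fsetUA.
- by apply: SLT_andl; rewrite !fsetUA -(fsetUA [fset Xn i a]).
- exact: SLT_andr.
- by apply: SLT_orl; rewrite fsetUA.
- exact: SLT_orr1.
- exact: SLT_orr2.
- by apply: (@SLT_Gl _ k); rewrite fsetUA.
- by apply: SLT_Gr.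
- by apply: SLT_Fl => j; rewrite fsetUA.
- exact: (@SLT_Fr _ k).
Qed.

Lemma SLT_weaken {G c} (H : {fset form}) : G `<=` H -> SLT G c -> SLT H c.
Proof. by move=> /fsetUidPr <-; apply: SLT_weakenU. Qed.

(** The index [i] must vary in the induction on [a]: [Xn i (Next a)] computes to [Xn i.+1 a], and
    the cases of [Glob] and [Fut] need every [i + j]. *)
Lemma SLT_identityX i a (G : {fset form}) :
  SLT (Xn i a |` G) (Some (Xn i a)).
Proof.
elim: a i G => [p|a IHa b IHb|a IHa b IHb|a IHa b IHb|a IHa|a IHa|a IHa|a IHa] i G.
- exact: SLT_init.
- by apply: SLT_impr; rewrite fsetUCA; apply: SLT_impl.
- by apply: SLT_andl; apply: SLT_andr => //; rewrite fsetUCA.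
- by apply: SLT_orl; [apply: SLT_orr1|apply: SLT_orr2].
- by apply: SLT_negr; rewrite fsetUCA; apply: SLT_negl.
- by apply: SLT_Gr => j; apply: (@SLT_Gl _ j).
- by apply: SLT_Fl => j; apply: (@SLT_Fr _ j).
- exact: (IHa i.+1).
Qed.

Lemma SLT_identity a (G : {fset form}) : SLT (a |` G) (Some a).
Proof. exact: (SLT_identityX 0). Qed.

Lemma SLT_neg_left a (G : {fset form}) :
  SLT (Neg a |` G) None <-> SLT G (Some a).
Proof.
split=> [d|]; last exact: (@SLT_negl 0).
by apply: (@SLT_em 0 a); [apply: SLT_wr|apply: SLT_identity].
Qed.

(** The negation stands outside every [Next], so the rules for [Neg] always apply to it at index
    0. *)
Definition negs (D : {fset form}) : {fset form} := [fset Neg a | a in D].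

Lemma SLT_negs_right a (G D : {fset form}) :
  SLT (G `|` negs (a |` D)) None <-> SLT (G `|` negs D) (Some a).
Proof. by rewrite /negs imfsetU1 fsetUCA; apply: SLT_neg_left. Qed.

Lemma LT_SLT {G D} : LT G D -> SLT (G `|` negs D) None.
Proof.
elim=> {G D}
  [i p|G D S P a _ /SLT_negs_right IHG _ IHS|a G D _ IH|a G D _ IH
  |i a b G D _ /SLT_negs_right IHa _ IHb|i a b G D _ /SLT_negs_right IH
  |i a G D _ /SLT_negs_right IH|i a G D _ IH|i a b G D _ IH
  |i a b G D _ /SLT_negs_right IHa _ /SLT_negs_right IHb
  |i a b G D _ IHa _ IHb|i a b G D _ /SLT_negs_right IH
  |i k a G D _ IH|i a G D _ IH|i a G D _ IH|i k a G D _ /SLT_negs_right IH];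
  (* When the last rule acts on the succedent, its principal formula is moved back there. *)
  try apply/SLT_negs_right; rewrite -?fsetUA.
- by rewrite /negs imfset_fset1 fsetUC; apply/SLT_neg_left;
    rewrite -[[fset _]]fsetU0; apply: SLT_init.
- by rewrite /negs imfsetU fsetUA fsetUACA; apply: (SLT_cut IHG); rewrite fsetUA.
- by apply: SLT_weaken IH; apply: fsubsetUr.
- exact: SLT_wr.
- by apply: SLT_impl; rewrite ?fsetUA.
- by apply: SLT_impr; rewrite fsetUA.
- exact: SLT_negl.
- by apply: SLT_negr; rewrite fsetUA.
- by apply: SLT_andl; rewrite !fsetUA -(fsetUA [fset Xn i a]).
- exact: SLT_andr.
- by apply: SLT_orl; rewrite fsetUA.
(* Case split on [Xn i b]: if it holds, so does the right disjunct; its negation is just what the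
   premise has in its antecedent to yield [Xn i a]. *)
- apply: (@SLT_em 0 (Xn i b)); last exact/SLT_orr2/SLT_identity.
  by apply: SLT_orr1; move: IH; rewrite /negs imfsetU1 fsetUCA.
- by apply: (@SLT_Gl _ k); rewrite fsetUA.
- by apply: SLT_Gr => j; apply/SLT_negs_right.
- by apply: SLT_Fl => j; rewrite fsetUA.
- exact: (@SLT_Fr _ k).
Qed.

Lemma LT_weakenl {G D} (H : {fset form}) : LT G D -> LT (H `|` G) D.
Proof.
move=> d; elim/fset1U_rect: H => [|a H _ IH]; first by rewrite fset0U.
by rewrite -fsetUA; apply: LT_wl.
Qed.

Lemma LT_weakenr {G D} (E : {fset form}) : LT G D -> LT G (E `|` D).
Proof.
move=> d; elim/fset1U_rect: E => [|a E _ IH]; first by rewrite fset0U.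
by rewrite -fsetUA; apply: LT_wr.
Qed.

Definition succedent (c : option form) : {fset form} :=
  if c is Some a then a |` fset0 else fset0.

Lemma SLT_LT {G c} : SLT G c -> LT G (succedent c).
Proof.
elim=> {G c} /=
  [i p G|G S a c _ IHG _ IHS|a G _ IH|i a b G c _ IHa _ IHb|i a b G _ IH
  |i a G _ IH|i a G _ IH|i a G c _ IHn _ IHa|i a b G c _ IH
  |i a b G _ IHa _ IHb|i a b G c _ IHa _ IHb|i a b G _ IH|i a b G _ IH
  |i k a G c _ IH|i a G _ IH|i a G c _ IH|i k a G _ IH].
- by rewrite fsetU0 fsetUC; apply: LT_weakenl; apply: LT_init.
- by rewrite -[succedent c]fset0U; apply: LT_cut IHG IHS.
- exact: LT_wr.
- apply: LT_impl => //.
  (* Both premises of [LT_impl] share a succedent, so the first one is weakened by [c]. *)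
  by rewrite -[succedent c]fsetU0 fsetUCA; apply: LT_weakenr.
- exact: LT_impr.
- exact: LT_negl.
- exact: LT_negr.
(* The cut duplicates context and succedent; idempotence of union serves as contraction. *)
- rewrite -[G]fsetUid -[succedent c]fsetUid.
  exact: LT_cut (LT_negr IHa) IHn.
- exact: LT_andl.
- exact: LT_andr.
- exact: LT_orl.
- by apply: LT_orr; rewrite fsetUCA; apply: LT_wr.
- by apply: LT_orr; apply: LT_wr.
- exact: LT_Gl IH.
- exact: LT_Gr.
- exact: LT_Fl.
- exact: LT_Fr IH.
Qed.

Theorem theorem2 (a : form) :
  SLT (fset0 : {fset form}) (Some a) <-> LT (fset0 : {fset form}) [fset a].
Proof.
split=> [/SLT_LT|/LT_SLT]; first by rewrite /= fsetU0.
by rewrite /negs imfset_fset1 fsetUC => /SLT_neg_left.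
Qed.
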